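(* Let $X\in\mathbb{R}^{n\times D}$ and $Y\in\mathbb{R}^{n\times m}$ with $D>n\geq r:=\mathrm{rank}(X)$, and let $h$ be a positive integer with $h\geq\min\{m,D\}$. Write the compact SVD of $X$ as $X=W\begin{bmatrix}\Sigma_x^{1/2} & 0\end{bmatrix}\begin{bmatrix}\Phi_1^T\\ \Phi_2^T\end{bmatrix}$, where $W\in\mathbb{R}^{n\times r}$ has orthonormal columns, $\Sigma_x\in\mathbb{R}^{r\times r}$ is diagonal with positive diagonal entries, $\Phi_1\in\mathbb{R}^{D\times r}$, $\Phi_2\in\mathbb{R}^{D\times(D-r)}$, and $[\Phi_1\ \Phi_2]$ is an orthogonal matrix. For $V\in\mathbb{R}^{m\times h}$ and $U_1\in\mathbb{R}^{r\times h}$ define the error $E(V,U_1)=W^TY-\Sigma_x^{1/2}U_1V^T$. Let $(V(t),U_1(t))$, $t\ge 0$, be the solution of $$\dot V=E^T\Sigma_x^{1/2}U_1,\qquad \dot U_1=\Sigma_x^{1/2}EV,$$ with $E=E(V(t),U_1(t))$, starting from some $(V(0),U_1(0))$ (together with $U_2(t)\equiv U_2(0)\in\mathbb{R}^{(D-r)\times h}$; this is exactly the gradient flow of $\mathcal{L}(V,U)=\frac12\|Y-XUV^T\|_F^2$ written in the coordinates $U=\Phi_1U_1+\Phi_2U_2$). Let $\mathcal{L}(t)=\frac12\|Y-XU(t)V(t)^T\|_F^2$ with $U(t)=\Phi_1U_1(t)+\Phi_2U_2(t)$, and $\mathcal{L}^*=\frac12\|(I-WW^T)Y\|_F^2$.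 Let $\Lambda(0)=U_1(0)^TU_1(0)-V(0)^TV(0)\in\mathbb{R}^{h\times h}$ and $$c:=[\lambda_r(\Lambda(0))]_++[\lambda_m(-\Lambda(0))]_+,$$ where $[a]_+=\max\{a,0\}$, and $\lambda_r(\Lambda(0))$ (resp. $\lambda_m(-\Lambda(0))$) is taken to be $0$ if $h<r$ (resp. $h<m$). Then $$\mathcal{L}(t)-\mathcal{L}^*\leq \exp\left(-2\lambda_r(\Sigma_x)\,c\,t\right)(\mathcal{L}(0)-\mathcal{L}^* )\quad\text{for all } t>0.$$ Moreover, if $h\geq m+r$, then $c=\lambda_r(\Lambda(0))+\lambda_m(-\Lambda(0))$. Additionally, if $c>0$, then $(V(t),U_1(t))$ converges as $t\to\infty$ to an equilibrium point $(V(\infty),U_1(\infty))$ such that $E(V(\infty),U_1(\infty))=0$.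
   Context: $\lambda_i(A)$ denotes the $i$-th largest eigenvalue of a symmetric matrix $A$. The matrix $\Lambda=U_1^TU_1-V^TV$ is called the imbalance of the network. $\mathcal{L}^*$ is the optimal value of $\min_{\Theta\in\mathbb{R}^{D\times m}}\frac12\|Y-X\Theta\|_F^2$. *)

(* Defs.v *)
From HB Require Import structures.
From mathcomp Require Import all_boot all_order all_algebra.
From mathcomp Require Import all_classical all_reals all_analysis.
Set Implicit Arguments. Unset Strict Implicit. Unset Printing Implicit Defensive.
Import Order.TTheory GRing.Theory Num.Theory.
Local Open Scope ring_scope.

(* Eigenvalues of a (symmetric) square matrix, counted with multiplicity and
   sorted in nonincreasing order: the sequence s of roots with
   char_poly A = \prod_(x <- s) ('X - x). For real symmetric matrices the
   characteristic polynomial splits over R, so such s exists and is unique. *)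
Definition eigen_seq (R : realType) (k : nat) (A : 'M[R]_k) : seq R :=
  xget [::] (fun s : seq R =>
    sorted (fun x y => y <= x) s /\ char_poly A = \prod_(x <- s) ('X - x%:P)).

(* lambda_i(A): the i-th largest eigenvalue (1-indexed); it is 0 if i = 0 or
   i > k (this matches the paper's convention "taken to be 0 if h < r"). *)
Definition lambda (R : realType) (k : nat) (A : 'M[R]_k) (i : nat) : R :=
  if (0 < i)%N then nth 0 (eigen_seq A) i.-1 else 0.

Definition pos_part (R : realType) (a : R) : R := Num.max a 0.

Definition frob2 (R : realType) (p q : nat) (A : 'M[R]_(p, q)) : R :=
  \sum_(i < p) \sum_(j < q) A i j ^+ 2.

(* Main.v *)
Require Import Defs.
From HB Require Import structures.
From mathcomp Require Import all_boot all_order all_algebra.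
From mathcomp Require Import perm complex ring lra zify.
From mathcomp Require Import all_classical all_reals all_analysis.
Import Order.TTheory GRing.Theory Num.Theory.
Import numFieldNormedType.Exports.
Local Open Scope classical_set_scope.
Local Open Scope ring_scope.

(* Put g = |E|^2 / 2, which is the excess loss. Along the flow
     g' = - (|V'|^2 + |U1'|^2) = - (|E^T Sx^(1/2) U1|^2 + |Sx^(1/2) E V|^2),
   and the imbalance L = U1^T U1 - V^T V is conserved. Since U1^T U1 >= L and
   V^T V >= - L, the smallest eigenvalues of U1 U1^T and V V^T are at least
   [lambda_r L]_+ and [lambda_m (-L)]_+, so g' <= - 2 lambda_r(Sx) c g.
   For the convergence, every entry f of (V, U1) satisfies f'^2 <= - g' while g
   decays exponentially, so f' is integrable; this is expressed by a function
   H tending to 0 with |f'| <= - H'. *)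

(** * Frobenius norm and diagonalization of real symmetric matrices *)

Section SymmetricMatrices.
Set Implicit Arguments.
Unset Strict Implicit.
Context {R : realType}.

Lemma frob2_ge0 p q (A : 'M[R]_(p, q)) : 0 <= frob2 A.
Proof. by apply: sumr_ge0 => i _; apply: sumr_ge0 => j _; rewrite sqr_ge0. Qed.

Lemma frob2_tr p q (A : 'M[R]_(p, q)) : frob2 A = \tr (A *m A^T).
Proof.
apply: eq_bigr => i _; rewrite mxE; apply: eq_bigr => j _.
by rewrite mxE expr2.
Qed.

Lemma frob2_trmx p q (A : 'M[R]_(p, q)) : frob2 A^T = frob2 A.
Proof. by rewrite !frob2_tr trmxK mxtrace_mulC. Qed.

Lemma frob2_ge_entry p q (A : 'M[R]_(p, q)) i j : A i j ^+ 2 <= frob2 A.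
Proof.
rewrite /frob2 (bigD1 i) //= (bigD1 j) //= -addrA lerDl addr_ge0 //.
  by apply: sumr_ge0 => ? _; rewrite sqr_ge0.
by apply: sumr_ge0 => ? _; apply: sumr_ge0 => ? _; rewrite sqr_ge0.
Qed.

Lemma frob20 p q : frob2 (0 : 'M[R]_(p, q)) = 0.
Proof.
by rewrite /frob2 big1 // => i _; rewrite big1 // => j _; rewrite mxE expr0n.
Qed.

Lemma frob2_eq0 p q (A : 'M[R]_(p, q)) : frob2 A <= 0 -> A = 0.
Proof.
move=> A0; apply/matrixP => i j; rewrite mxE; apply/eqP.
by rewrite -sqrf_eq0 eq_le sqr_ge0 andbT (le_trans (frob2_ge_entry A i j)).
Qed.

Lemma frob2_diag p q (z : 'M[R]_(p, q)) (d : 'rV[R]_q) :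
  \tr (z *m diag_mx d *m z^T) = \sum_i \sum_j d 0 j * z i j ^+ 2.
Proof.
apply: eq_bigr => i _; rewrite mxE; apply: eq_bigr => j _.
by rewrite mul_mx_diag !mxE; ring.
Qed.

(* The real and imaginary parts x, y of a complex eigenvector for a + ib satisfy
   xA = ax - by and yA = bx + ay; symmetry of A gives b (|x|^2 + |y|^2) = 0. *)
Lemma symmetric_eigenvector n (A : 'M[R]_n.+1) : A^T = A ->
  exists (v : 'rV_n.+1) (a : R), v != 0 /\ v *m A = a *: v.
Proof.
move=> symA.
pose C : numClosedFieldType := complex R.
pose Ac : 'M[C]_n.+1 := map_mx (real_complex R) A.
have /closed_rootP[[a b]] : size (char_poly Ac) != 1%N by rewrite size_char_poly.
rewrite -eigenvalue_root_char => /eigenvalueP[v vA v0].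
pose x := map_mx (@complex.Re R) v; pose y := map_mx (@complex.Im R) v.
have xA : x *m A = a *: x - b *: y.
  apply/matrixP => i j; have /matrixP/(_ i j)/(congr1 (@complex.Re R)) := vA.
  rewrite !mxE raddf_sum /=; case: (v i j) => vr vi /= <-.
  by apply: eq_bigr => k _; rewrite !mxE; case: (v i k) => p q /=; ring.
have yA : y *m A = a *: y + b *: x.
  apply/matrixP => i j; have /matrixP/(_ i j)/(congr1 (@complex.Im R)) := vA.
  rewrite !mxE raddf_sum /=; case: (v i j) => vr vi /= <-.
  by apply: eq_bigr => k _; rewrite !mxE; case: (v i k) => p q /=; ring.
have xy : \tr (x *m A *m y^T) = \tr (y *m A *m x^T).
  by rewrite -mxtrace_tr !trmx_mul trmxK symA mulmxA.
have yx : \tr (x *m y^T) = \tr (y *m x^T).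
  by rewrite -mxtrace_tr !trmx_mul trmxK.
move: xy; rewrite xA yA !mulmxDl mulNmx -!scalemxAl !mxtraceD raddfN /= !mxtraceZ.
rewrite yx -!frob2_tr => /(addrI _) /eqP.
rewrite -subr_eq0 -opprD oppr_eq0. rewrite -mulrDr mulf_eq0 => /orP[/eqP b0|].
  (* With b = 0 the relations decouple: [x] and [y] each satisfy the eigenvector equation for [a],
     and they cannot both vanish since [v] is nonzero. *)
  have [x0|xn0] := eqVneq x 0; last first.
    by exists x, a; rewrite xA b0 scale0r subr0.
  exists y, a; rewrite yA b0 scale0r addr0; split=> //.
  apply: contraNneq v0 => y0; apply/eqP/matrixP => i j.
  move/matrixP/(_ i j): x0; move/matrixP/(_ i j): y0; rewrite !mxE.
  by case: (v i j) => p q /= -> ->.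
rewrite paddr_eq0 ?frob2_ge0 // => /andP[/eqP y0 /eqP x0].
case/eqP: v0; apply/matrixP => i j.
have /matrixP/(_ i j) : x = 0 by apply: frob2_eq0; rewrite x0.
have /matrixP/(_ i j) : y = 0 by apply: frob2_eq0; rewrite y0.
by rewrite !mxE; case: (v i j) => p q /= -> ->.
Qed.

(* Householder reflection along v - u. *)
Lemma exists_reflection n (u v : 'rV[R]_n) : u *m u^T = 1 -> v *m v^T = 1 ->
  exists Q : 'M[R]_n, [/\ Q^T = Q, Q *m Q = 1%:M & u *m Q = v].
Proof.
move=> u1 v1; pose w := v - u.
(* If u = v the identity serves; otherwise the factor 2 / |w|^2 is well defined. *)
have [w0|w0] := eqVneq w 0.
  exists 1%:M; rewrite trmx1 mulmx1 mulmx1; split=> //.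
  by apply/eqP; rewrite eq_sym -subr_eq0 -/w w0.
pose s := frob2 w.
have s0 : s != 0.
  by apply: contra w0 => /eqP s0; apply/eqP/frob2_eq0; rewrite -/s s0.
have ww : w *m w^T = s%:M by rewrite /s frob2_tr trace_mx11 -mx11_scalar.
pose Q := 1%:M - (2 / s) *: (w^T *m w).
exists Q; split.
- by rewrite /Q raddfB /= trmx1 linearZ /= trmx_mul trmxK.
- have : w^T *m w *m (w^T *m w) = s *: (w^T *m w).
    by rewrite mulmxA -(mulmxA w^T) ww mul_mx_scalar -scalemxAl.
  rewrite /Q; move: (w^T *m w) => M MM.
  rewrite mulmxBr mulmx1 mulmxBl mul1mx -scalemxAl -scalemxAr MM.
  by apply/matrixP => i j; rewrite !mxE; field.
- rewrite /Q mulmxBr mulmx1 -scalemxAr mulmxA.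
  (* For unit vectors s = |v - u|^2 = 2 (1 - <u, v>), hence <u, w> = <u, v> - 1 = - s / 2, and so Q
     maps u to u + w = v. *)
  have uw : u *m w^T = - (s / 2)%:M.
    have uv : u *m v^T = v *m u^T.
      by rewrite [LHS]mx11_scalar -tr_scalar_mx -mx11_scalar trmx_mul trmxK.
    have : (s%:M : 'M[R]_1) = 2%:R *: (1 - v *m u^T).
      rewrite -ww /w raddfB /= mulmxBr !mulmxBl u1 v1 uv.
      by apply/matrixP => i j; rewrite !mxE; ring.
    move=> /(congr1 (fun M => 2^-1 *: M)).
    rewrite scalerA mulVf ?pnatr_eq0 // scale1r scale_scalar_mx => sE.
    by rewrite /w raddfB /= mulmxBr u1 uv mulrC sE opprB.
  rewrite uw mulNmx mul_scalar_mx scalerN opprK scalerA.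
  rewrite [X in X *: _](_ : _ = 1); last by field.
  by rewrite scale1r /w addrC subrK.
Qed.

(** Induction on the size by deflation: a reflection carrying the first basis vector to a unit
    eigenvector conjugates A into a block diagonal matrix made of the eigenvalue and a smaller
    symmetric block. *)
Lemma spectral_theorem n (A : 'M[R]_n) : A^T = A ->
  exists (Q : 'M[R]_n) (d : 'rV[R]_n),
    Q *m Q^T = 1%:M /\ A = Q^T *m diag_mx d *m Q.
Proof.
elim: n A => [|n IH] A symA.
  by exists 1%:M, 0; split; apply/matrixP => -[].
have [v0 [a [v0n0 v0A]]] := symmetric_eigenvector symA.
have s0 : 0 < frob2 v0.
  by rewrite lt_neqAle frob2_ge0 andbT eq_sym; apply: contra v0n0 => /eqP s0;
     apply/eqP/frob2_eq0; rewrite s0.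
pose v := (Num.sqrt (frob2 v0))^-1 *: v0.
have v1 : v *m v^T = 1.
  rewrite /v linearZ /= -scalemxAl -scalemxAr scalerA -invfM -expr2 sqr_sqrtr ?ltW //.
  rewrite [v0 *m _]mx11_scalar -trace_mx11 -frob2_tr scale_scalar_mx mulVf ?gt_eqF //.
have vA : v *m A = a *: v by rewrite /v -scalemxAl v0A !scalerA mulrC.
pose e : 'rV[R]_(1 + n) := row_mx 1 0.
have e1 : e *m e^T = 1.
  by rewrite /e tr_row_mx mul_row_col trmx1 trmx0 mulmx0 addr0 mulmx1.
have [Q [Qs QQ eQ]] := exists_reflection (e1 : (e : 'rV_n.+1) *m _ = 1) v1.
pose B : 'M[R]_(1 + n) := Q *m A *m Q.
have Bs : B^T = B by rewrite /B !trmx_mul Qs symA mulmxA.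
have eB : e *m B = a *: e.
  by rewrite /B !mulmxA eQ vA -scalemxAl -eQ -mulmxA QQ mulmx1.
(* The equation [e *m B = a *: e] is the first row of B; symmetry then clears the first column. *)
have [ul ur] : ulsubmx B = a%:M /\ ursubmx B = 0.
  move: eB; rewrite -[B]submxK /e mul_row_block !mul1mx !mul0mx !addr0.
  rewrite scale_row_mx scaler0 => /eq_row_mx[-> ->].
  by rewrite !block_mxKul !block_mxKur scalemx1.
have dl : dlsubmx B = 0 by rewrite -Bs -trmx_ursub ur trmx0.
have [P [d [PP drE]]] : exists (P : 'M[R]_n) (d : 'rV[R]_n),
    P *m P^T = 1%:M /\ drsubmx B = P^T *m diag_mx d *m P.
  by apply: IH; rewrite trmx_drsub Bs.
pose P1 : 'M[R]_(1 + n) := block_mx 1%:M 0 0 P.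
pose d1 : 'rV[R]_(1 + n) := row_mx a%:M d.
have PP1 : P1 *m P1^T = 1%:M.
  rewrite /P1 tr_block_mx mulmx_block !trmx0 trmx1.
  by rewrite !mulmx0 !mul0mx mulmx1 !addr0 add0r PP -scalar_mx_block.
have BE : B = P1^T *m diag_mx d1 *m P1.
  rewrite -[LHS]submxK ul ur dl drE /P1 /d1 diag_mx_row tr_block_mx !mulmx_block.
  rewrite !trmx0 trmx1 !mulmx0 !mul0mx !mulmx1 !mul1mx !addr0 !add0r.
  by congr (block_mx _ _ _ _); rewrite ?mul0mx //; apply/matrixP => i j; rewrite !ord1 !mxE.
have AE : A = Q *m B *m Q.
  by rewrite /B !mulmxA QQ mul1mx -mulmxA QQ mulmx1.
exists (P1 *m Q), d1; split.
  by rewrite trmx_mul Qs mulmxA -(mulmxA _ Q Q) QQ mulmx1.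
by rewrite AE BE trmx_mul Qs !mulmxA.
Qed.

(** * Sorted eigenvalues and orthonormal eigenvectors *)

Lemma char_poly_conj n (Q A : 'M[R]_n) : Q *m Q^T = 1%:M ->
  char_poly (Q^T *m A *m Q) = char_poly A.
Proof.
move=> /mulmx1C QQ; rewrite /char_poly.
have QQ' : map_mx polyC Q^T *m map_mx polyC Q = 1%:M.
  by rewrite -map_mxM QQ map_scalar_mx.
have -> : char_poly_mx (Q^T *m A *m Q) =
    map_mx polyC Q^T *m char_poly_mx A *m map_mx polyC Q.
  rewrite /char_poly_mx mulmxBr mulmxBl !map_mxM /= scalar_mxC -(mulmxA _%:M).
  by rewrite QQ' mulmx1.
by rewrite !det_mulmx mulrAC -det_mulmx QQ' det1 mul1r.
Qed.

(** Since [eigen_seq] is a choice with default [[::]], its specification must first be shown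
    satisfiable: sorting d does this. Unique factorization into linear factors then identifies the
    chosen sequence up to order. *)
Lemma eigen_seq_of_prod n (A : 'M[R]_n) (d : 'rV[R]_n) :
  char_poly A = \prod_i ('X - (d 0 i)%:P) ->
  sorted (fun x y => y <= x) (eigen_seq A) /\
  perm_eq (eigen_seq A) [seq d 0 i | i : 'I_n].
Proof.
move=> dA; pose s := [seq d 0 i | i : 'I_n].
have sA : char_poly A = \prod_(x <- s) ('X - x%:P).
  by rewrite big_map big_enum.
pose ge := fun x y : R => y <= x.
have ge_total : total ge by move=> x y; exact: le_total.
have : exists t : seq R, sorted ge t /\ char_poly A = \prod_(x <- t) ('X - x%:P).
  exists (sort ge s); split; first exact: sort_sorted.
  by rewrite sA; apply: perm_big; rewrite perm_sym perm_sort.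
move=> /(xgetPex [::]) [es_sorted es_prod].
by split=> //; apply: prod_XsubC_eq; rewrite -sA -es_prod.
Qed.

Lemma eigen_seq_spectral n (A : 'M[R]_n) : A^T = A ->
  exists Q : 'M[R]_n, Q *m Q^T = 1%:M /\
    Q *m A *m Q^T = diag_mx (\row_i nth 0 (eigen_seq A) i) /\
    size (eigen_seq A) = n /\ sorted (fun x y => y <= x) (eigen_seq A).
Proof.
move=> /spectral_theorem[Q [d [QQ AE]]].
have [sortA permA] : sorted (fun x y => y <= x) (eigen_seq A) /\
  perm_eq (eigen_seq A) [seq d 0 i | i : 'I_n].
  apply: eigen_seq_of_prod; rewrite {1}AE char_poly_conj // char_poly_trig.
    by apply: eq_bigr => i _; rewrite !mxE eqxx.
  exact: diag_mx_is_trig.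
have sizeA : size (eigen_seq A) = n by rewrite (perm_size permA) size_map size_enum_ord.
pose t := [tuple d 0 i | i < n].
(* The permutation [p] lists the diagonal entries in decreasing order; applying it to the rows of Q
   reorders the eigenvectors accordingly. *)
have /tuple_permP[p eE] : perm_eq (eigen_seq A) t.
  by rewrite (perm_trans permA) //= map_comp.
have nthE (i : 'I_n) : nth 0 (eigen_seq A) i = d 0 (p i).
  by rewrite eE nth_mktuple tnth_mktuple.
have rpE : row_perm p Q *m (row_perm p Q)^T = 1%:M.
  rewrite tr_row_perm; apply/matrixP => i j.
  have /matrixP/(_ (p i) (p j)) := QQ.
  by rewrite !mxE (inj_eq perm_inj) => <-; apply: eq_bigr => k _; rewrite !mxE.
exists (row_perm p Q); split=> //; split=> //.
have DE : Q *m A *m Q^T = diag_mx d.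
  by rewrite AE !mulmxA QQ mul1mx -mulmxA QQ mulmx1.
apply/matrixP => i j; have /matrixP/(_ (p i) (p j)) := DE.
rewrite tr_row_perm !mxE nthE (inj_eq perm_inj) => <-.
apply: eq_bigr => k _; rewrite !mxE; congr (_ * _).
by apply: eq_bigr => l _; rewrite !mxE.
Qed.

(** The rows of B are the eigenvectors selected by f. It is used below with the leading eigenvectors
    and with a tail of them. *)
Lemma eigen_frame n k (A : 'M[R]_n) (f : 'I_k -> 'I_n) : A^T = A -> injective f ->
  exists B : 'M[R]_(k, n), B *m B^T = 1%:M /\
    B *m A *m B^T = diag_mx (\row_i nth 0 (eigen_seq A) (f i)).
Proof.
move=> /eigen_seq_spectral[Q [QQ [AQ _]]] f_inj.
have trf : (rowsub f Q)^T = colsub f Q^T by apply/matrixP => i j; rewrite !mxE.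
exists (rowsub f Q); rewrite trf -mxsub_mul QQ [rowsub f Q *m A]mul_rowsub_mx.
rewrite -mxsub_mul AQ.
by split; apply/matrixP => i j; rewrite !mxE (inj_eq f_inj).
Qed.

(** Beyond the size of the matrix [lambda] takes its default value 0, so a positive value certifies
    that the index is in range. *)
Lemma lambda_gt0_le n k (A : 'M[R]_n) : A^T = A -> 0 < lambda A k -> (k <= n)%N.
Proof.
move=> /eigen_seq_spectral[Q [_ [_ [sizeA _]]]]; rewrite /lambda.
case: k => [|k] //=; rewrite ltnNge; apply: contraL => nk.
by rewrite nth_default ?ltxx // sizeA.
Qed.

Lemma eigen_seq_nth_le n (A : 'M[R]_n) i j : A^T = A -> (i <= j < n)%N ->
  nth 0 (eigen_seq A) j <= nth 0 (eigen_seq A) i.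
Proof.
move=> /eigen_seq_spectral[Q [_ [_ [sizeA sortA]]]] /andP[ij jn].
apply: (sorted_leq_nth _ _ 0 sortA) => //; rewrite ?inE ?sizeA //.
  by move=> x y z /= xy yz; exact: le_trans yz xy.
exact: leq_ltn_trans jn.
Qed.

(** * Eigenvalues of the imbalance and bounds on the factors *)

Lemma trace_gram_sub r m h p (U : 'M[R]_(r, h)) (V : 'M[R]_(m, h)) (z : 'M[R]_(p, h)) :
  \tr (z *m (U^T *m U - V^T *m V) *m z^T) = frob2 (z *m U^T) - frob2 (z *m V^T).
Proof.
by rewrite !frob2_tr !trmx_mul !trmxK mulmxBr mulmxBl raddfB /= !mulmxA.
Qed.

Lemma gram_sub_sym r m h (U : 'M[R]_(r, h)) (V : 'M[R]_(m, h)) :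
  (U^T *m U - V^T *m V)^T = U^T *m U - V^T *m V.
Proof. by rewrite raddfB /= !trmx_mul !trmxK. Qed.

(* On the span of the top r eigenvectors (the rows of B) one has |zBU^T|^2 >= a|z|^2,
   so BU^T is invertible; writing y = zBU^T and expanding |yU - a zB|^2 >= 0 transposes
   this bound into one for U. *)
Lemma pos_part_lambda_gram r m h p (U : 'M[R]_(r, h)) (V : 'M[R]_(m, h))
    (y : 'M[R]_(p, r)) :
  pos_part (lambda (U^T *m U - V^T *m V) r) * frob2 y <= frob2 (y *m U).
Proof.
have symA := gram_sub_sym U V.
set A := _ - _ in symA *; set a := lambda A r.
have [a0|a0] := leP a 0.
  by rewrite /pos_part max_r // mul0r frob2_ge0.
rewrite /pos_part max_l; last exact: ltW.
have rh := lambda_gt0_le symA a0.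
have w_inj : injective (widen_ord rh) by move=> i j /(congr1 val) /= /val_inj.
have [B [BB BA]] := eigen_frame symA w_inj.
(* In the eigenbasis the form at zB is a sum of squares weighted by the top r eigenvalues, all at
   least a; the form also equals |zBU^T|^2 - |zBV^T|^2, whose second term is dropped. *)
have lower q (z : 'M[R]_(q, r)) : a * frob2 z <= frob2 (z *m (B *m U^T)).
  apply: (@le_trans _ _ (\tr ((z *m B) *m A *m (z *m B)^T))).
    rewrite trmx_mul !mulmxA -(mulmxA z) -(mulmxA z) BA frob2_diag /frob2 mulr_sumr.
    apply: ler_sum => i _; rewrite mulr_sumr; apply: ler_sum => j _.
    rewrite ler_wpM2r ?sqr_ge0 // !mxE /a /lambda.
    have r0 : (0 < r)%N by case: (r) j => [[]|].
    rewrite r0; apply: eigen_seq_nth_le => //=.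
    by rewrite -ltnS prednK // ltn_ord /=.
  by rewrite trace_gram_sub mulmxA gerBl frob2_ge0.
have Nunit : B *m U^T \in unitmx.
  rewrite -row_free_unit -kermx_eq0; apply/eqP; apply: frob2_eq0.
  have := lower _ (kermx (B *m U^T)).
  by rewrite mulmx_ker frob20 pmulr_rle0.
pose z := y *m invmx (B *m U^T).
have zy : z *m (B *m U^T) = y by rewrite /z -mulmxA mulVmx // mulmx1.
have az : a * frob2 z <= frob2 y by rewrite -zy lower.
have : 0 <= frob2 (y *m U - a *: (z *m B)) by exact: frob2_ge0.
have tr1 : \tr (y *m U *m (z *m B)^T) = frob2 y.
  by rewrite frob2_tr -{3}zy !trmx_mul trmxK !mulmxA.
have tr2 : \tr (z *m B *m (y *m U)^T) = frob2 y.
  by rewrite -tr1 -mxtrace_tr !trmx_mul !trmxK !mulmxA.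
have tr3 : \tr (z *m B *m (z *m B)^T) = frob2 z.
  by rewrite trmx_mul !mulmxA -(mulmxA z) BB mulmx1 frob2_tr.
have -> : frob2 (y *m U - a *: (z *m B)) =
    frob2 (y *m U) - a * frob2 y - a * (frob2 y - a * frob2 z).
  rewrite frob2_tr.
  have -> : (y *m U - a *: (z *m B))^T = (y *m U)^T - a *: (z *m B)^T.
    by rewrite linearB linearZ.
  rewrite mulmxBr !mulmxBl -!scalemxAr -!scalemxAl.
  by rewrite !raddfB /= !mxtraceZ tr1 tr2 tr3 -frob2_tr; ring.
(* The expanded square gives |yU|^2 >= a|y|^2 + a (|y|^2 - a|z|^2), and the last term is nonnegative
   by [az]. *)
move: az a0; nra.
Qed.

(* The eigenvectors of the r-th and smaller eigenvalues span a space of dimension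
   h - r + 1 > m, so it meets the kernel of V, where the form is nonnegative. *)
Lemma lambda_gram_ge0 r m h (U : 'M[R]_(r, h)) (V : 'M[R]_(m, h)) :
  (m + r <= h)%N -> 0 <= lambda (U^T *m U - V^T *m V) r.
Proof.
have symA := gram_sub_sym U V.
set A := _ - _ in symA * => mrh; rewrite /lambda; case: ltnP => // r0.
rewrite leNgt; apply/negP => neg.
(* Positions in [eigen_seq] start at 0, so the r-th eigenvalue sits at [r.-1], where the tail
   begins. *)
have fP (i : 'I_(h - r.-1)) : (r.-1 + i < h)%N.
  by have := ltn_ord i; lia.
pose f i := Ordinal (fP i).
have f_inj : injective f by move=> i j /(congr1 val) /addnI /val_inj.
have [B [BB BA]] := eigen_frame symA f_inj.
have : kermx (B *m V^T) != 0.
  rewrite kermx_eq0 /row_free; apply/negP => /eqP rkE.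
  by have := rank_leq_col (B *m V^T); rewrite rkE; lia.
move=> /negP; apply; apply/eqP/frob2_eq0.
have zN : kermx (B *m V^T) *m (B *m V^T) = 0 by exact: mulmx_ker.
move: (kermx _) zN => z zN.
have trE : \tr (z *m (B *m A *m B^T) *m z^T) = frob2 (z *m B *m U^T).
  have := trace_gram_sub U V (z *m B).
  have -> : z *m B *m V^T = 0 by rewrite -mulmxA.
  by rewrite frob20 subr0 -/A => <-; rewrite trmx_mul !mulmxA.
have : 0 <= \tr (z *m (B *m A *m B^T) *m z^T) by rewrite trE frob2_ge0.
rewrite BA frob2_diag => tr0.
have : 0 <= nth 0 (eigen_seq A) r.-1 * frob2 z.
  apply: le_trans tr0 _; rewrite /frob2 mulr_sumr.
  apply: ler_sum => i _; rewrite mulr_sumr; apply: ler_sum => j _.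
  rewrite ler_wpM2r ?sqr_ge0 // !mxE; apply: eigen_seq_nth_le => //=.
  by rewrite leq_addr fP.
by rewrite nmulr_rge0.
Qed.

(** * Smallest eigenvalue of a diagonal matrix *)

Lemma perm_eigen_seq_diag r (d : 'rV[R]_r) :
  perm_eq (eigen_seq (diag_mx d)) [seq d 0 i | i : 'I_r].
Proof.
have [|_ //] := @eigen_seq_of_prod _ (diag_mx d) d.
rewrite char_poly_trig ?diag_mx_is_trig //.
by apply: eq_bigr => j _; rewrite !mxE eqxx.
Qed.

Lemma lambda_diag_le r (d : 'rV[R]_r) i : lambda (diag_mx d) r <= d 0 i.
Proof.
have symD : (diag_mx d)^T = diag_mx d by rewrite tr_diag_mx.
have permd := perm_eigen_seq_diag d.
have sized : size (eigen_seq (diag_mx d)) = r.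
  by rewrite (perm_size permd) size_map size_enum_ord.
have r0 : (0 < r)%N by case: (r) i => [[]|].
have : d 0 i \in eigen_seq (diag_mx d).
  by rewrite (perm_mem permd); apply/mapP; exists i; rewrite ?mem_enum.
move=> /(nthP 0)[k]; rewrite sized => kr <-.
by rewrite /lambda r0 eigen_seq_nth_le // -ltnS prednK // kr /=.
Qed.

Lemma lambda_diag_gt0 r (d : 'rV[R]_r) : (0 < r)%N -> (forall i, 0 < d 0 i) ->
  0 < lambda (diag_mx d) r.
Proof.
move=> r0 d0.
have permd := perm_eigen_seq_diag d.
rewrite /lambda r0.
have : nth 0 (eigen_seq (diag_mx d)) r.-1 \in eigen_seq (diag_mx d).
  by apply: mem_nth; rewrite (perm_size permd) size_map size_enum_ord ltn_predL.
by rewrite (perm_mem permd) => /mapP[i _ ->].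
Qed.

End SymmetricMatrices.

(** * Entrywise limits of matrix-valued functions *)

Section MatrixLimits.
Set Implicit Arguments.
Unset Strict Implicit.
Context {R : realType} {T : Type} {F : set_system T} {FF : Filter F}.

Lemma cvg_mxP p q (A : T -> 'M[R]_(p, q)) (a : 'M[R]_(p, q)) :
  A x @[x --> F] --> a <-> forall i j, A x i j @[x --> F] --> a i j.
Proof.
split=> [Aa i j|Aa].
  by apply: (@cvg_comp _ _ _ A (fun M : 'M[R]_(p, q) => M i j) _ _ _ Aa);
     exact: coord_continuous.
apply/cvgrPdist_le => /= e e0; near=> x.
rewrite /Num.Def.normr/= mx_normrE (bigmax_le _ (ltW e0))//= => i _.
rewrite !mxE/=; move: i; near: x; apply: filter_forall => /= i.
by have /cvgrPdist_le := Aa i.1 i.2; exact.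
Unshelve. all: by end_near. Qed.

Lemma cvg_mulmx p q r (A : T -> 'M[R]_(p, q)) (B : T -> 'M[R]_(q, r))
    (a : 'M[R]_(p, q)) (b : 'M[R]_(q, r)) :
  A x @[x --> F] --> a -> B x @[x --> F] --> b ->
  A x *m B x @[x --> F] --> a *m b.
Proof.
move=> /cvg_mxP Aa /cvg_mxP Bb; apply/cvg_mxP => i j.
rewrite mxE; under eq_fun do rewrite mxE.
apply: cvg_big => [|k _]; first exact: add_continuous.
exact: cvgM.
Qed.

Lemma cvg_trmx p q (A : T -> 'M[R]_(p, q)) (a : 'M[R]_(p, q)) :
  A x @[x --> F] --> a -> (A x)^T @[x --> F] --> a^T.
Proof.
move=> /cvg_mxP Aa; apply/cvg_mxP => i j.
by rewrite mxE; under eq_fun do rewrite mxE; exact: Aa.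
Qed.

Lemma cvg_frob2 p q (A : T -> 'M[R]_(p, q)) (a : 'M[R]_(p, q)) :
  A x @[x --> F] --> a -> frob2 (A x) @[x --> F] --> frob2 a.
Proof.
move=> /cvg_mxP Aa.
apply: cvg_big => [|i _]; first exact: add_continuous.
apply: cvg_big => [|j _]; first exact: add_continuous.
by under eq_fun do rewrite expr2; rewrite expr2; exact: cvgM.
Qed.

End MatrixLimits.

(** * Product and transpose rules for matrix derivatives *)

Section MatrixDerivatives.
Set Implicit Arguments.
Unset Strict Implicit.
Context {R : realType}.
Implicit Type t : R.

Lemma is_derive_mxP p q (A : R -> 'M[R]_(p, q)) t (dA : 'M[R]_(p, q)) :
  is_derive t 1 A dA <-> forall i j, is_derive t 1 (fun s => A s i j) (dA i j).
Proof.
split=> [[Ad <-] i j|Ad].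
  rewrite derive_mx // mxE; apply: DeriveDef => //.
  by move/derivable_mxP: Ad.
have dA' : derivable A t 1 by apply/derivable_mxP => i j; have [] := Ad i j.
apply: DeriveDef => //.
by rewrite derive_mx //; apply/matrixP => i j; rewrite mxE; have [] := Ad i j.
Qed.

Lemma is_derive_mulmx p q r (A : R -> 'M[R]_(p, q)) (B : R -> 'M[R]_(q, r)) t
    (dA : 'M[R]_(p, q)) (dB : 'M[R]_(q, r)) :
  is_derive t 1 A dA -> is_derive t 1 B dB ->
  is_derive t 1 (fun s => A s *m B s) (dA *m B t + A t *m dB).
Proof.
move=> /is_derive_mxP dA' /is_derive_mxP dB'; apply/is_derive_mxP => i j.
have -> : (fun s => (A s *m B s) i j) =
    \sum_(k < q) ((fun s => A s i k) * (fun s => B s k j)).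
  by apply/funext => s; rewrite mxE fct_sumE.
apply: (is_derive_eq (is_derive_sum (fun k => is_deriveM (dA' i k) (dB' k j)))).
rewrite !mxE -big_split; apply: eq_bigr => k _ /=.
by rewrite /GRing.scale /=; ring.
Qed.

Lemma is_derive_trmx p q (A : R -> 'M[R]_(p, q)) t (dA : 'M[R]_(p, q)) :
  is_derive t 1 A dA -> is_derive t 1 (fun s => (A s)^T) dA^T.
Proof.
move=> /is_derive_mxP dA'; apply/is_derive_mxP => i j; rewrite mxE.
by under eq_fun do rewrite mxE; exact: dA'.
Qed.

Lemma is_derive_frob2 p q (A : R -> 'M[R]_(p, q)) t (dA : 'M[R]_(p, q)) :
  is_derive t 1 A dA ->
  is_derive t 1 (fun s => frob2 (A s)) (2 * \tr (dA *m (A t)^T)).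
Proof.
move=> /is_derive_mxP dA'.
have -> : (fun s => frob2 (A s)) =
    \sum_(i < p) \sum_(j < q) ((fun s => A s i j) * (fun s => A s i j)).
  by apply/funext => s; rewrite fct_sumE; apply: eq_bigr => i _; rewrite fct_sumE;
     apply: eq_bigr => j _; rewrite expr2.
apply: (is_derive_eq (is_derive_sum (fun i => is_derive_sum (fun j =>
  is_deriveM (dA' i j) (dA' i j))))).
rewrite mulr_sumr; apply: eq_bigr => i _; rewrite mxE mulr_sumr.
by apply: eq_bigr => j _; rewrite mxE /GRing.scale /=; ring.
Qed.

End MatrixDerivatives.

(** * Monotonicity, exponential decay and convergence of scalar functions *)

Section ScalarEstimates.
Set Implicit Arguments.
Unset Strict Implicit.
Context {R : realType}.
Implicit Types (f g q df : R -> R) (t : R).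

(** Differentiability is assumed only for t > 0, as in the flow; right-continuity extends the
    monotonicity to the endpoint 0. *)
Lemma derive_le0_nonincr f df : (forall t, 0 < t -> is_derive t 1 f (df t)) ->
  f x @[x --> 0^'+] --> f 0 -> (forall t, 0 < t -> df t <= 0) ->
  forall x y, 0 <= x -> x <= y -> f y <= f x.
Proof.
move=> fd f0 df0; apply: ler0_derive1_nincry.
- by move=> t; rewrite in_itv /= andbT => /fd [].
- move=> t; rewrite in_itv /= andbT => t0; have [_ dft] := fd t t0.
  by rewrite derive1E dft df0.
- apply: derivable_oy_Rcontinuous_within_itvcy; split=> // t.
  by rewrite in_itv /= andbT => /fd [].
Qed.

Lemma derive_eq0_cst f : (forall t, 0 < t -> is_derive t 1 f 0) ->
  f x @[x --> 0^'+] --> f 0 -> forall t, 0 <= t -> f t = f 0.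
Proof.
move=> fd f0 t t0; apply/eqP; rewrite eq_le.
rewrite (derive_le0_nonincr fd f0 (fun t _ => lexx 0)) //= -lerN2.
apply: (@derive_le0_nonincr (- f) (fun=> - 0)) => // [s s0|].
- by have := fd s s0; exact: is_deriveN.
- exact: cvgN.
Qed.

Lemma is_derive_expRM (k t : R) :
  is_derive t 1 (fun s => expR (k * s)) (k * expR (k * t)).
Proof.
have lin : is_derive t 1 (fun s : R => k * s) k.
  apply: (is_derive_eq (is_deriveZ k (is_derive_id t 1))).
  by rewrite /GRing.scale /= mulr1.
apply: (is_derive_eq (is_derive1_comp (is_derive_expR (k * t)) lin)).
exact: mulrC.
Qed.

Lemma cvg_expRM (k a : R) : expR (k * x) @[x --> a^'+] --> expR (k * a).
Proof.
apply: cvg_at_right_filter.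
have [ed _] := is_derive_expRM k a.
by move/derivable1_diffP/differentiable_continuous: ed; exact.
Qed.

Lemma cvg_expRNM (k : R) : 0 < k -> expR (- k * t) @[t --> +oo] --> (0 : R).
Proof.
move=> k0; under eq_fun do rewrite mulNr.
have kt : k * t @[t --> +oo] --> +oo by apply: gt0_cvgMry => //; exact: cvg_id.
exact: (cvg_comp _ _ kt (@cvgr_expR R)).
Qed.

(** Grönwall's argument: g(t) e^(kt) has derivative (k g - q) e^(kt) <= 0. *)
Lemma exp_decay g q (k : R) : (forall t, 0 < t -> is_derive t 1 g (- q t)) ->
  g x @[x --> 0^'+] --> g 0 -> (forall t, 0 < t -> k * g t <= q t) ->
  forall t, 0 <= t -> g t <= expR (- k * t) * g 0.
Proof.
move=> gd g0 gq t t0.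
have : g t * expR (k * t) <= g 0 * expR (k * 0).
  apply: (@derive_le0_nonincr (g * (fun s => expR (k * s)))
    (fun s => g s * (k * expR (k * s)) + expR (k * s) * (- q s))) => //.
  - move=> s s0; exact: is_deriveM (gd s s0) (is_derive_expRM k s).
  - by apply: cvgM => //; exact: cvg_expRM.
  - move=> s s0; have := gq s s0; have := expR_gt0 (k * s); nra.
rewrite mulr0 expR0 mulr1 -ler_pdivlMr ?expR_gt0 //.
by rewrite -expRN mulNr mulrC.
Qed.

(** The function f + H is nonincreasing and bounded below by f(0) - H(0), because f + H >= f - H and
    f - H is nondecreasing. So f + H converges, and H tends to 0. *)
Lemma nonincr_sandwich_cvg f (H : R -> R) :
  (forall x y, 0 <= x -> x <= y -> f y + H y <= f x + H x) ->
  (forall x y, 0 <= x -> x <= y -> f x - H x <= f y - H y) ->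
  (forall t, 0 <= t -> 0 <= H t) -> H t @[t --> +oo] --> 0 ->
  exists l : R, f t @[t --> +oo] --> l.
Proof.
move=> up dn H0 Hcvg.
(* Freezing the argument at 0 for negative t makes [phi] monotone on the whole line, as monotone
   convergence requires. *)
pose phi (t : R) := - (f (Num.max t 0) + H (Num.max t 0)).
have phi_nd : {homo phi : x y / x <= y}.
  move=> x y xy; rewrite lerN2; apply: up; first by rewrite le_max lexx orbT.
  by rewrite ge_max !le_max xy lexx !orbT.
have phi_ub : has_ubound (range phi).
  exists (- (f 0 - H 0)) => _ [t _ <-]; rewrite lerN2.
  have t0 : 0 <= Num.max t 0 by rewrite le_max lexx orbT.
  have := dn _ _ (lexx 0) t0; have := H0 _ t0; lra.
have phi_cvg := nondecreasing_cvgr phi_nd phi_ub.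
exists (- sup (range phi) - 0).
have : - phi t - H t @[t --> +oo] --> - sup (range phi) - 0.
  by apply: cvgB => //; exact: cvgN.
apply: cvg_trans; apply: near_eq_cvg; near=> t.
have t0 : 0 <= t by near: t; apply: nbhs_pinfty_ge; exact: num_real.
by rewrite /phi max_l // opprK addrK.
Unshelve. all: by end_near. Qed.

(* The witness H makes f + H and f - H monotone: by AM-GM,
   - H' >= (q e^(kt) + e^(-kt)) / 2 >= sqrt q >= |f'|. *)
Lemma cvg_of_gradient_decay f df g q (k : R) : 0 < k ->
  (forall t, 0 < t -> is_derive t 1 g (- q t)) -> g x @[x --> 0^'+] --> g 0 ->
  (forall t, 0 < t -> 2 * k * g t <= q t) -> (forall t, 0 <= t -> 0 <= g t) ->
  (forall t, 0 < t -> is_derive t 1 f (df t)) -> f x @[x --> 0^'+] --> f 0 ->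
  (forall t, 0 < t -> df t ^+ 2 <= q t) ->
  exists l : R, f t @[t --> +oo] --> l.
Proof.
move=> k0 gd gcvg gq g_ge0 fd fcvg dfq.
have decay := exp_decay gd gcvg gq.
(* Chosen so that k C = (k g(0) + 1) / 2: in - H' the first part absorbs the term - k g e^(kt) / 2,
   since g e^(kt) <= g(0) e^(-kt), and the rest leaves e^(-kt) / 2. *)
pose C := (k * g 0 + 1) / (2 * k).
have kC : k * C = (k * g 0 + 1) / 2 by rewrite /C; field; rewrite gt_eqF.
pose w t := expR (k * t); pose u t := expR (- k * t).
have uw t : u t * w t = 1 by rewrite /u /w -expRD mulNr addNr expR0.
have w0 t : 0 < w t by exact: expR_gt0.
have u0 t : 0 < u t by exact: expR_gt0.
pose H : R -> R := 2^-1 *: (g * w) + C *: u.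
pose dH t := 2^-1 * (g t * (k * w t) + w t * (- q t)) + C * (- k * u t).
have Hd t : 0 < t -> is_derive t 1 H (dH t).
  move=> t0; apply: is_deriveD; apply: is_deriveZ; last exact: is_derive_expRM.
  exact: is_deriveM (gd t t0) (is_derive_expRM k t).
have Hcvg0 : H x @[x --> 0^'+] --> H 0.
  apply: cvgD; apply: cvgM; [exact: cvg_cst| |exact: cvg_cst|exact: cvg_expRM].
  by apply: cvgM => //; exact: cvg_expRM.
have gw t : 0 <= t -> g t * w t <= g 0 * u t.
  move=> t0; have := decay t t0.
  have -> : expR (- (2 * k) * t) = u t * u t.
    by rewrite /u -expRD; congr expR; ring.
  move=> gt; apply: (@le_trans _ _ (u t * u t * g 0 * w t)).
    by rewrite ler_pM2r.
  by rewrite mulrAC -(mulrA (u t)) uw mulr1 mulrC.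
have dH_le t : 0 < t -> `|df t| <= - dH t.
  move=> t0; have := gw t (ltW t0) => gwt.
  have CE : C * (- k * u t) = - (k * g 0 + 1) / 2 * u t.
    by rewrite mulrA mulrN (mulrC C) kC; ring.
  have kgw : k * (g t * w t) <= k * (g 0 * u t) by rewrite ler_pM2l.
  have qw : df t ^+ 2 * w t <= q t * w t by rewrite ler_pM2r // dfq.
  have sq : 0 <= w t * (`|df t| - u t) ^+ 2 by rewrite mulr_ge0 ?sqr_ge0 // ltW.
  have sqE : w t * (`|df t| - u t) ^+ 2 = df t ^+ 2 * w t - 2 * `|df t| + u t.
    rewrite -[df t ^+ 2]real_normK ?num_real //.
    have -> : w t * (`|df t| - u t) ^+ 2 =
        `|df t| ^+ 2 * w t - 2 * `|df t| * (u t * w t) + u t * (u t * w t) by ring.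
    by rewrite uw !mulr1.
  rewrite /dH CE; move: sq; rewrite sqE; lra.
have C_ge0 : 0 <= C.
  by rewrite divr_ge0 ?addr_ge0 ?mulr_ge0 ?g_ge0 // ltW.
have H_ge0 t : 0 <= t -> 0 <= H t.
  move=> t0; apply: addr_ge0; apply: mulr_ge0 => //.
  - by apply: mulr_ge0; [exact: g_ge0|exact: ltW].
  - exact: ltW.
have H_le t : 0 <= t -> H t <= (2^-1 * g 0 + C) * u t.
  move=> t0; rewrite mulrDl -mulrA; apply: lerD => //.
  by apply: ler_wpM2l; [rewrite invr_ge0|exact: gw].
have Hlim : H t @[t --> +oo] --> (0 : R).
  apply: (@squeeze_cvgr _ _ _ _ (fun=> 0) (fun t => (2^-1 * g 0 + C) * u t)).
  - near=> t.
    have t0 : 0 <= t by near: t; apply: nbhs_pinfty_ge; exact: num_real.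
    by rewrite H_ge0 // H_le.
  - exact: cvg_cst.
  - rewrite -[X in _ --> X](mulr0 (2^-1 * g 0 + C)); apply: cvgM; first exact: cvg_cst.
    exact: cvg_expRNM.
clearbody H dH.
have up x y : 0 <= x -> x <= y -> (f + H) y <= (f + H) x.
  apply: (@derive_le0_nonincr _ (fun t => df t + dH t)).
  - by move=> t t0; apply: is_deriveD; [exact: fd|exact: Hd].
  - exact: cvgD.
  - by move=> t t0; have := dH_le t t0; have := ler_norm (df t); lra.
have dn x y : 0 <= x -> x <= y -> (H - f) y <= (H - f) x.
  apply: (@derive_le0_nonincr _ (fun t => dH t - df t)).
  - by move=> t t0; apply: is_deriveB; [exact: Hd|exact: fd].
  - exact: cvgB.
  - by move=> t t0; have := dH_le t t0; have := ler_norm (- df t); rewrite normrN; lra.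
apply: (nonincr_sandwich_cvg up _ H_ge0 Hlim) => x y x0 xy.
by rewrite -lerN2 !opprB; exact: dn.
Unshelve. all: by end_near. Qed.

End ScalarEstimates.

(** * Geometry of the loss and of its gradient *)

Section GradientFlow.
Set Implicit Arguments.
Unset Strict Implicit.
Context {R : realType}.

Lemma frob2_pythagoras n r m (W : 'M[R]_(n, r)) (P : 'M[R]_(n, m)) (E : 'M[R]_(r, m)) :
  W^T *m W = 1%:M -> W^T *m P = 0 -> frob2 (P + W *m E) = frob2 P + frob2 E.
Proof.
move=> WW WP.
have PW : P^T *m W = 0 by rewrite -[LHS]trmxK trmx_mul trmxK WP trmx0.
rewrite -!(frob2_trmx (_ + _)) -(frob2_trmx P) -(frob2_trmx E) !frob2_tr !trmxK.
have -> : (P + W *m E)^T = P^T + E^T *m W^T by rewrite linearD /= trmx_mul.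
rewrite mulmxDl !mulmxDr !mulmxA PW -(mulmxA _ _ P) WP.
by rewrite -(mulmxA _ _ W) WW mulmx1 mul0mx mulmx0 addr0 add0r mxtraceD.
Qed.

Lemma frob2_sqrt_diag_ge r m (d : 'rV[R]_r) (E : 'M[R]_(r, m)) :
  (forall i, 0 < d 0 i) ->
  lambda (diag_mx d) r * frob2 E <= frob2 (diag_mx (map_mx Num.sqrt d) *m E).
Proof.
move=> d0; rewrite /frob2 mulr_sumr; apply: ler_sum => i _.
rewrite mulr_sumr; apply: ler_sum => j _.
rewrite mul_diag_mx !mxE exprMn sqr_sqrtr; last exact: ltW.
by rewrite ler_wpM2r ?sqr_ge0 // lambda_diag_le.
Qed.

Lemma pos_part_ge0 (a : R) : 0 <= pos_part a.
Proof. by rewrite /pos_part le_max lexx orbT. Qed.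

(** Each summand is bounded in two stages: the Gram bound removes the factor U or V, then the
    smallest entry of d removes [Sxh]. The V term uses that - Lam is the imbalance with U and V
    exchanged. *)
Lemma gradient_lower_bound r m h (d : 'rV[R]_r) (E : 'M[R]_(r, m))
    (V : 'M[R]_(m, h)) (U : 'M[R]_(r, h)) :
  let Sxh := diag_mx (map_mx Num.sqrt d) in
  let Lam := U^T *m U - V^T *m V in
  (forall i, 0 < d 0 i) ->
  lambda (diag_mx d) r * (pos_part (lambda Lam r) + pos_part (lambda (- Lam) m)) *
    frob2 E <= frob2 (E^T *m Sxh *m U) + frob2 (Sxh *m E *m V).
Proof.
move=> Sxh Lam d0; rewrite mulrDr mulrDl; apply: lerD.
  apply: le_trans (pos_part_lambda_gram U V (E^T *m Sxh)).
  rewrite (mulrC (lambda _ _)) -mulrA ler_wpM2l ?pos_part_ge0 //.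
  rewrite -(frob2_trmx (_ *m Sxh)) trmx_mul trmxK tr_diag_mx.
  exact: frob2_sqrt_diag_ge.
have -> : - Lam = V^T *m V - U^T *m U by rewrite opprB.
apply: le_trans (pos_part_lambda_gram V U (Sxh *m E)).
rewrite (mulrC (lambda _ _)) -mulrA ler_wpM2l ?pos_part_ge0 //.
exact: frob2_sqrt_diag_ge.
Qed.

(** * Conservation and dissipation along a trajectory *)

Section Trajectory.
Variables (r m h : nat) (S : 'M[R]_r) (G : 'M[R]_(r, m)).
Variables (V : R -> 'M[R]_(m, h)) (U : R -> 'M[R]_(r, h)).
Hypothesis symS : S^T = S.
Let E t : 'M[R]_(r, m) := G - S *m U t *m (V t)^T.
Let dV t := (E t)^T *m S *m U t.
Let dU t := S *m E t *m V t.
Hypothesis Vd : forall t : R, 0 < t -> is_derive t 1 V (dV t).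
Hypothesis Ud : forall t : R, 0 < t -> is_derive t 1 U (dU t).
Hypothesis V0 : V x @[x --> 0^'+] --> V 0.
Hypothesis U0 : U x @[x --> 0^'+] --> U 0.

Lemma imbalance_constant (t : R) : 0 <= t ->
  (U t)^T *m U t - (V t)^T *m V t = (U 0)^T *m U 0 - (V 0)^T *m V 0.
Proof.
move=> t0; pose Lam s : 'M[R]_h := (U s)^T *m U s - (V s)^T *m V s.
suff : Lam t = Lam 0 by [].
have Lamd (s : R) : 0 < s -> is_derive s 1 Lam 0.
  move=> s0.
  apply: (is_derive_eq (is_deriveB
    (is_derive_mulmx (is_derive_trmx (Ud s0)) (Ud s0))
    (is_derive_mulmx (is_derive_trmx (Vd s0)) (Vd s0)))).
  (* Both Gram matrices have derivative V^T E^T S U + U^T S E V, with the summands in opposite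
     orders. *)
  rewrite /dU /dV !trmx_mul !trmxK symS !mulmxA.
  by rewrite [X in _ - X]addrC subrr.
have Lam0 : Lam x @[x --> 0^'+] --> Lam 0.
  by apply: cvgB; apply: cvg_mulmx => //; exact: cvg_trmx.
apply/matrixP => i j; apply: (@derive_eq0_cst _ (fun s => Lam s i j)) => // [s s0|].
  by have /is_derive_mxP/(_ i j) := Lamd s s0; rewrite mxE.
by move/cvg_mxP: Lam0; exact.
Qed.

Lemma error_cvg (F : set_system R) (FF : Filter F)
    (Vl : 'M[R]_(m, h)) (Ul : 'M[R]_(r, h)) :
  V x @[x --> F] --> Vl -> U x @[x --> F] --> Ul ->
  E x @[x --> F] --> G - S *m Ul *m Vl^T.
Proof.
move=> Vcvg Ucvg; apply: cvgB; first exact: cvg_cst.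
apply: cvg_mulmx; last exact: cvg_trmx.
by apply: cvg_mulmx => //; exact: cvg_cst.
Qed.

(** Pairing E' with E under the trace, cyclicity turns the two product-rule terms into - |V'|^2 and
    - |U1'|^2. *)
Lemma loss_derive (t : R) : 0 < t ->
  is_derive t 1 (fun s => 2^-1 * frob2 (E s)) (- (frob2 (dV t) + frob2 (dU t))).
Proof.
move=> t0.
have Sd : is_derive t 1 (fun=> S) 0 by exact: is_derive_cst.
have Gd : is_derive t 1 (fun=> G) 0 by exact: is_derive_cst.
have Ed : is_derive t 1 E (- (S *m dU t *m (V t)^T + S *m U t *m (dV t)^T)).
  apply: (is_derive_eq (is_deriveB Gd (is_derive_mulmx
    (is_derive_mulmx Sd (Ud t0)) (is_derive_trmx (Vd t0))))).
  by rewrite mul0mx !add0r.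
apply: (is_derive_eq (is_deriveZ 2^-1 (is_derive_frob2 Ed))).
rewrite /GRing.scale /= mulrA mulVf ?pnatr_eq0 // mul1r mulNmx raddfN /=; congr (- _).
rewrite mulmxDl mxtraceD addrC; congr (_ + _).
  by rewrite mxtrace_mulC frob2_tr !mulmxA.
rewrite frob2_tr.
have -> : (dU t)^T = (V t)^T *m (E t)^T *m S by rewrite /dU !trmx_mul symS mulmxA.
by rewrite mulmxA [in RHS]mxtrace_mulC !mulmxA.
Qed.

End Trajectory.
End GradientFlow.

(** * Rate of the excess loss and limit of the flow *)

Theorem theorem1 (R : realType) (n D m h r : nat)
  (X : 'M[R]_(n, D)) (Y : 'M[R]_(n, m))
  (W : 'M[R]_(n, r)) (d : 'rV[R]_r)
  (Phi1 : 'M[R]_(D, r)) (Phi2 : 'M[R]_(D, D - r))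
  (V : R -> 'M[R]_(m, h)) (U1 : R -> 'M[R]_(r, h)) (U2 : 'M[R]_(D - r, h)) :
  (n < D)%N -> (r <= n)%N -> \rank X = r ->
  (0 < h)%N -> (minn m D <= h)%N ->
  (* compact SVD of X *)
  W^T *m W = 1%:M ->
  (forall i, 0 < d 0 i) ->
  Phi1^T *m Phi1 = 1%:M -> Phi2^T *m Phi2 = 1%:M -> Phi1^T *m Phi2 = 0 ->
  Phi1 *m Phi1^T + Phi2 *m Phi2^T = 1%:M ->
  let Sx : 'M[R]_r := diag_mx d in
  let Sxh : 'M[R]_r := diag_mx (map_mx Num.sqrt d) in
  X = W *m row_mx Sxh (0 : 'M[R]_(r, D - r)) *m col_mx Phi1^T Phi2^T ->
  let E (Va : 'M[R]_(m, h)) (U1a : 'M[R]_(r, h)) : 'M[R]_(r, m) :=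
    W^T *m Y - Sxh *m U1a *m Va^T in
  (* (V, U1) solves the ODE for t > 0 and is right-continuous at t = 0 *)
  (forall t : R, 0 < t ->
     derivable V t 1 /\ derivable U1 t 1 /\
     'D_1 V t = (E (V t) (U1 t))^T *m Sxh *m U1 t /\
     'D_1 U1 t = Sxh *m E (V t) (U1 t) *m V t) ->
  V x @[x --> 0^'+] --> V 0 -> U1 x @[x --> 0^'+] --> U1 0 ->
  let U (t : R) : 'M[R]_(D, h) := Phi1 *m U1 t + Phi2 *m U2 in
  let L (t : R) : R := 2^-1 * frob2 (Y - X *m U t *m (V t)^T) in
  let Lstar : R := 2^-1 * frob2 ((1%:M - W *m W^T) *m Y) in
  let Lam0 : 'M[R]_h := (U1 0)^T *m U1 0 - (V 0)^T *m V 0 in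
  let c : R := pos_part (lambda Lam0 r) + pos_part (lambda (- Lam0) m) in
  (forall t : R, 0 < t ->
     L t - Lstar <= expR (- 2 * lambda Sx r * c * t) * (L 0 - Lstar))
  /\ ((m + r <= h)%N -> c = lambda Lam0 r + lambda (- Lam0) m)
  /\ (0 < c -> exists (Vinf : 'M[R]_(m, h)) (U1inf : 'M[R]_(r, h)),
        V t @[t --> +oo] --> Vinf /\ U1 t @[t --> +oo] --> U1inf /\
        E Vinf U1inf = 0).
Proof.
move=> nD rn rkX h0 mDh WW d0 P11 P22 P12 PP Sx Sxh XE E ode V0 U0 U L Lstar Lam0 c.
have symS : Sxh^T = Sxh by rewrite tr_diag_mx.
pose g (t : R) := 2^-1 * frob2 (E (V t) (U1 t)).
pose dV (t : R) := (E (V t) (U1 t))^T *m Sxh *m U1 t.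
pose dU (t : R) := Sxh *m E (V t) (U1 t) *m V t.
have Vd (t : R) : 0 < t -> is_derive t 1 V (dV t).
  by move=> /ode[? [? [? ?]]]; exact: DeriveDef.
have Ud (t : R) : 0 < t -> is_derive t 1 U1 (dU t).
  by move=> /ode[? [? [? ?]]]; exact: DeriveDef.
have Lg t : L t - Lstar = g t.
  (* The zero block of the SVD annihilates the [U2] component. The residual then splits into a part
     orthogonal to the columns of W, which gives [Lstar], and W E, which gives [g]. *)
  have XU : X *m U t = W *m Sxh *m U1 t.
    have P21 : Phi2^T *m Phi1 = 0 by rewrite -[LHS]trmxK trmx_mul trmxK P12 trmx0.
    have CU : col_mx Phi1^T Phi2^T *m U t = col_mx (U1 t) U2.
      rewrite /U mul_col_mx !mulmxDr !mulmxA P11 P12 P22 P21.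
      by rewrite !mul1mx !mul0mx addr0 add0r.
    by rewrite XE -mulmxA CU -mulmxA mul_row_col mul0mx addr0 mulmxA.
  rewrite /L /Lstar.
  have -> : Y - X *m U t *m (V t)^T =
      (1%:M - W *m W^T) *m Y + W *m E (V t) (U1 t).
    by rewrite XU /E mulmxBr mulmxBl mul1mx !mulmxA addrA subrK.
  rewrite frob2_pythagoras //; last first.
    by rewrite !mulmxA mulmxBr mulmx1 !mulmxA WW mul1mx subrr mul0mx.
  by rewrite mulrDr addrC addKr.
have gd (t : R) : 0 < t -> is_derive t 1 g (- (frob2 (dV t) + frob2 (dU t))).
  exact: loss_derive.
have Ecvg (F : set_system R) (FF : Filter F) Vl Ul : V x @[x --> F] --> Vl ->
    U1 x @[x --> F] --> Ul -> E (V x) (U1 x) @[x --> F] --> E Vl Ul.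
  exact: error_cvg.
have g0 : g x @[x --> 0^'+] --> g 0.
  by apply: cvgM; [exact: cvg_cst|apply: cvg_frob2; exact: Ecvg].
have gE t : 2 * g t = frob2 (E (V t) (U1 t)).
  by rewrite /g mulrA mulfV ?mul1r // pnatr_eq0.
have g_ge0 t : 0 <= g t by rewrite mulr_ge0 ?invr_ge0 ?ler0n ?frob2_ge0.
have gq (t : R) : 0 < t ->
    2 * (lambda Sx r * c) * g t <= frob2 (dV t) + frob2 (dU t).
  (* Conservation replaces the initial imbalance in [c] by the one at time t, where the pointwise
     gradient bound applies. *)
  move=> t0; rewrite mulrAC gE mulrC /c /Lam0.
  rewrite -(imbalance_constant symS Vd Ud V0 U0 (ltW t0)).
  exact: gradient_lower_bound.
split; [|split].
- move=> t t0; rewrite !Lg.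
  have := exp_decay gd g0 gq (ltW t0).
  by rewrite !mulNr !mulrA.
- move=> mrh; rewrite /c /pos_part !max_l //.
    by rewrite opprB lambda_gram_ge0 // addnC.
  exact: lambda_gram_ge0.
- move=> c0.
  have [k k0 kq] : exists2 k : R, 0 < k & forall t : R, 0 < t ->
      2 * k * g t <= frob2 (dV t) + frob2 (dU t).
    (* For r = 0 the value [lambda Sx r] is 0 by convention and gives no rate; but E then has no
       rows, so g = 0 and k = 1 works. *)
    have [r0|r0] := posnP r.
      exists 1 => // t _; rewrite mulr1 gE.
      rewrite [X in X <= _](_ : _ = 0) ?addr_ge0 ?frob2_ge0 //.
      by rewrite /frob2 big1 // => i; have := ltn_ord i; rewrite {2}r0.
    by exists (lambda Sx r * c) => //; rewrite mulr_gt0 // lambda_diag_gt0.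
  have entry_cvg p q (A dA : R -> 'M[R]_(p, q)) :
      (forall t : R, 0 < t -> is_derive t 1 A (dA t)) ->
      A x @[x --> 0^'+] --> A 0 ->
      (forall t : R, 0 < t -> frob2 (dA t) <= frob2 (dV t) + frob2 (dU t)) ->
      exists Al : 'M[R]_(p, q), A t @[t --> +oo] --> Al.
    move=> Ad A0 dAq.
    have /choice[l lP] : forall ij : 'I_p * 'I_q,
        exists l : R, A t ij.1 ij.2 @[t --> +oo] --> l.
      move=> [i j] /=.
      apply: (cvg_of_gradient_decay k0 gd g0 kq (fun t _ => g_ge0 t)
        (df := fun t => dA t i j)).
      + by move=> t t0; have /is_derive_mxP := Ad t t0; exact.
      + by move/cvg_mxP : A0; exact.
      + by move=> t t0; apply: le_trans (dAq t t0); exact: frob2_ge_entry.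
    exists (\matrix_(i, j) l (i, j)); apply/cvg_mxP => i j.
    by rewrite mxE; exact: lP (i, j).
  have [Vinf Vcvg] : exists Vl : 'M[R]_(m, h), V t @[t --> +oo] --> Vl.
    by apply: (entry_cvg _ _ V dV) => // t _; rewrite lerDl frob2_ge0.
  have [Uinf Ucvg] : exists Ul : 'M[R]_(r, h), U1 t @[t --> +oo] --> Ul.
    by apply: (entry_cvg _ _ U1 dU) => // t _; rewrite lerDr frob2_ge0.
  exists Vinf, Uinf; split=> //; split=> //; apply: frob2_eq0.
  have Einf : frob2 (E (V t) (U1 t)) @[t --> +oo] --> frob2 (E Vinf Uinf).
    by apply: cvg_frob2; exact: Ecvg.
  (* Continuity gives |E|^2 the limit |E(Vinf, Uinf)|^2, while |E|^2 = 2 g <= 2 g(0) e^(-2kt) gives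
     it the limit 0. *)
  have E0 : frob2 (E (V t) (U1 t)) @[t --> +oo] --> (0 : R).
    apply: (@squeeze_cvgr _ _ _ _ (fun=> 0) (fun t => 2 * g 0 * expR (- (2 * k) * t))).
    + near=> t; rewrite frob2_ge0 -gE -mulrA ler_pM2l ?ltr0n //= mulrC.
      apply: (exp_decay gd g0 kq).
      by near: t; apply: nbhs_pinfty_ge; exact: num_real.
    + exact: cvg_cst.
    + rewrite -[X in _ --> X](mulr0 (2 * g 0)); apply: cvgM; first exact: cvg_cst.
      by apply: cvg_expRNM; rewrite mulr_gt0.
  by rewrite (norm_cvg_unique Einf E0).
Unshelve. all: by end_near.
Qed.
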